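(* Fix $x\in X$ with $\|x\|=1$, and for a norm $p$ on $cabv(X,0)$ let $\rho_p$ be the metric on $T$ given by $\rho_p(t,s)=p(\delta_tx-\delta_sx)$. Then the metrics $d$, $\rho_{\|\cdot\|_{MK}}$, $\rho_{\|\cdot\|_{MK}^{*}}$ and $\rho_{\|\cdot\|_H}$ on $T$ are Lipschitz equivalent. Namely, one has $$\frac{1}{1+\operatorname{diam}(T)}\,d\le\rho_{\|\cdot\|_{MK}}\le d,\qquad \rho_{\|\cdot\|_{MK}^{*}}=d,\qquad \frac{1}{\max(\operatorname{diam}(T),1)}\,d\le\rho_{\|\cdot\|_H}\le d.$$ The metric $\rho_{\|\cdot\|}$ generates the discrete topology on $T$, and it is equivalent to $d$ if and only if $T$ is finite.
   Context: $(T,d)$ is a compact metric space with at least two elements, with Borel $\sigma$-algebra $\mathcal{B}$; $\operatorname{diam}(T)=\sup\{d(x,y):x,y\in T\}$. $X$ is a nonzero Hilbert space over $K$ ($K=\mathbb{R}$ or $K=\mathbb{C}$), with scalar product $(\cdot\mid\cdot)$ (linear in the first variable, conjugate-linear in the second) and norm $\|\cdot\|$. $C(X)$ is the space of continuous functions $f:T\to X$ with the sup norm $\|f\|=\sup_{t\in T}\|f(t)\|$. $cabv(X)$ is the vector space over $K$ of $\sigma$-additive measures $\mu:\mathcal{B}\to X$ of bounded variation, where the variation is $|\mu|(A)=\sup\sum_i\|\mu(A_i)\|$ over finite partitions $(A_i)$ of $A$ into Borel sets; $\|\mu\|=|\mu|(T)$ is the variational norm. $cabv(X,0)=\{\mu\in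 cabv(X):\mu(T)=0\}$. For $t\in T$, $\delta_t$ is the Dirac measure at $t$, and $\delta_tx\in cabv(X)$ is the measure $A\mapsto\delta_t(A)x$. Integral: for a simple function $f=\sum_{i=1}^m\varphi_{A_i}x_i$ ($A_i\in\mathcal{B}$, $x_i\in X$, $\varphi_{A}$ the indicator function of $A$) put $\int f\,d\mu=\sum_{i=1}^m(x_i\mid\mu(A_i))\in K$; for $f\in C(X)$ put $\int f\,d\mu=\lim_n\int f_n\,d\mu$, where $(f_n)$ is any sequence of simple functions converging uniformly to $f$ (the limit exists and does not depend on the sequence; the integral is linear in $f$, conjugate-linear in $\mu$, and $|\int f\,d\mu|\le\|\mu\|\|f\|$). $L(X)$ is the space of Lipschitz functions $f:T\to X$, $\|f\|_L$ is the least Lipschitz constant of $f$, $\|f\|_{BL}=\|f\|+\|f\|_L$, $BL_1(X)=\{f\in L(X):\|f\|_{BL}\le1\}$, $L_1(X)=\{f\in L(X):\|f\|_L\le1\}$. The norms involved are: $\|\mu\|_{MK}=\sup\{|\int f\,d\mu|: f\in BL_1(X)\}$ (on $cabv(X)$); $\|\mu\|_{MK}^{*}=\sup\{|\int f\,d\mu|: f\in L_1(X)\}$ (on $cabv(X,0)$); $\|\mu\|_H=\inf\{\|\nu\|_{MK}^{*}+\|\mu-\nu\|:\nu\in cabv(X,0)\}$ (on $cabv(X)$). Norms on $cabv(X)$ are restricted to $cabv(X,0)$. In the last sentence of the claim, two metrics are equivalent if they generate the same topology. *)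

(* Defs.v *)
From HB Require Import structures.
From mathcomp Require Import all_boot all_order all_algebra.
From mathcomp Require Import sesquilinear.
From mathcomp Require Import all_classical all_reals all_analysis.
From mathcomp Require Import complex.

Set Implicit Arguments.
Unset Strict Implicit.
Unset Printing Implicit Defensive.

Import Order.TTheory GRing.Theory Num.Theory.
Import numFieldNormedType.Exports.

Local Open Scope classical_set_scope.
Local Open Scope ring_scope.

(* The two possible scalar fields, R itself and R[i]. *)
Variant scalar_kind := RealScalars | ComplexScalars.

Definition scalars (R : realType) (k : scalar_kind) : numFieldType :=
  match k with
  | RealScalars => R
  | ComplexScalars => R[i]
  end.

(* A scalar product on X is a [{dot X for scal_conj}]: linear in the first
   variable, conjugate-linear in the second. *)
Definition scal_conj (R : realType) (k : scalar_kind) :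
    scalars R k -> scalars R k :=
  match k return scalars R k -> scalars R k with
  | RealScalars => idfun
  | ComplexScalars => @conjc R
  end.

Definition scal_re (R : realType) (k : scalar_kind) : scalars R k -> R :=
  match k return scalars R k -> R with
  | RealScalars => idfun
  | ComplexScalars => @complex.Re R
  end.
Arguments scal_conj {R k}.
Arguments scal_re {R k}.

(* In the library the norm of a K-normed module has values in K; [norm] is the
   same nonnegative number, seen as an element of R. It is also used for the
   absolute value on K itself. *)
Definition norm (R : realType) (k : scalar_kind)
  (V : normedZmodType (scalars R k)) (v : V) : R := scal_re `|v|.

Section metrics.
Variables (R : realType) (T : Type).
Implicit Types rho : T -> T -> R.

Definition is_metric rho : Prop :=
  [/\ forall t s, 0 <= rho t s,
      forall t s, rho t s = 0 <-> t = s,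
      forall t s, rho t s = rho s t &
      forall t s u, rho t u <= rho t s + rho s u].

(* the topology generated by rho, as its family of open sets *)
Definition metric_open rho : set (set T) :=
  [set U | forall t, U t ->
    exists2 r : R, 0 < r & [set s | rho t s < r] `<=` U].

Definition lipschitz_equivalent rho1 rho2 : Prop :=
  exists a b : R, [/\ 0 < a, 0 < b &
    forall t s, a * rho1 t s <= rho2 t s <= b * rho1 t s].

End metrics.

Lemma metric_open_mdist (R : realType) (T : metricType R) :
  metric_open (@mdist R T) = [set U | open U].
Proof.
apply/seteqP; split=> U /=.
- move=> h; rewrite openE => t /h[r r0 sub]; apply/nbhs_ballP; exists r => //.
  by rewrite ballEmdist.
- rewrite openE => h t /h /nbhs_ballP[r r0 sub]; exists r => //.
  by rewrite -ballEmdist.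
Qed.

Section vector_measures.
Variables (R : realType) (k : scalar_kind).
Local Notation K := (scalars R k).
Variables (T : metricType R) (X : completeNormedModType K) (dot : X -> X -> K).
Implicit Types (mu nu : set T -> X) (f : T -> X) (A : set T) (t s : T) (x : X).

Definition diam : R := sup [set d | exists t s, d = mdist t s].

Definition borel : set (set T) := <<s [set A : set T | open A] >>.

(* A measure is a total function [set T -> X] of which only the values at the
   Borel sets matter. *)
Definition vsigma_additive mu : Prop :=
  forall F : nat -> set T, (forall i, borel (F i)) -> trivIset setT F ->
    (fun n => \sum_(0 <= i < n) mu (F i)) @ \oo --> mu (\bigcup_i F i).

Definition variation mu A : \bar R :=
  ereal_sup [set v | exists (n : nat) (F : nat -> set T),
    [/\ forall i, (i < n)%N -> borel (F i),
        trivIset `I_n F,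
        \bigcup_(i < n) F i = A &
        v = (\sum_(i < n) norm (mu (F i)))%:E]].

Definition cabv : set (set T -> X) :=
  [set mu | vsigma_additive mu /\ (variation mu setT < +oo)%E].

Definition cabv0 : set (set T -> X) :=
  [set mu | cabv mu /\ mu setT = 0].

Definition vnorm mu : R := fine (variation mu setT).

(* delta_t x *)
Definition vdirac t x : set T -> X := fun A => (\1_A t : K) *: x.

(* The sequence [:: (A_1, x_1); ...; (A_m, x_m)] represents the simple function
   \sum_i \1_(A_i) x_i; the A_i need not be disjoint. *)
Definition simple_fun (s : seq (set T * X)) : T -> X :=
  fun t => \sum_(p <- s) (\1_(p.1) t : K) *: p.2.

Definition simple_int mu (s : seq (set T * X)) : K :=
  \sum_(p <- s) dot p.2 (mu p.1).

(* For mu in cabv and f continuous on a compact T, there are such sequences s_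
   and they all give the same limit l, so [xget] picks that limit. *)
Definition vint mu f : K :=
  xget 0 [set l : K | exists s_ : nat -> seq (set T * X),
    [/\ forall n, {in s_ n, forall p, borel p.1},
        {uniform, (fun n => simple_fun (s_ n)) @ \oo --> f} &
        (fun n => simple_int mu (s_ n)) @ \oo --> l]].

Definition lip_bound f : set R :=
  [set L | 0 <= L /\ forall t s, norm (f t - f s) <= L * mdist t s].

Definition lip f : Prop := lip_bound f !=set0.

Definition norm_L f : R := inf (lip_bound f).

Definition norm_sup f : R := sup [set norm (f t) | t in setT].

Definition norm_BL f : R := norm_sup f + norm_L f.

Definition L1 : set (T -> X) := [set f | lip f /\ norm_L f <= 1].

Definition BL1 : set (T -> X) := [set f | lip f /\ norm_BL f <= 1].

Definition norm_MK mu : R := sup [set norm (vint mu f : K^o) | f in BL1].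

Definition norm_MKstar mu : R := sup [set norm (vint mu f : K^o) | f in L1].

Definition norm_H mu : R :=
  inf [set norm_MKstar nu + vnorm (mu - nu) | nu in cabv0].

Definition rho (p : (set T -> X) -> R) x t s : R :=
  p (vdirac t x - vdirac s x).

End vector_measures.
Arguments diam {R} T.

(* Main.v *)
Require Import Defs.
From HB Require Import structures.
From mathcomp Require Import all_boot all_order all_algebra.
From mathcomp Require Import sesquilinear.
From mathcomp Require Import all_classical all_reals all_analysis.
From mathcomp Require Import complex.
From mathcomp Require Import zify ring lra.

Set Implicit Arguments.
Unset Strict Implicit.
Unset Printing Implicit Defensive.

Import Order.TTheory GRing.Theory Num.Theory.
Import numFieldNormedType.Exports.

Local Open Scope classical_set_scope.
Local Open Scope ring_scope.

(* The integral of [f] against [delta_t x - delta_s x] is [dot (f t - f s) x], so by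
   Cauchy-Schwarz it is at most [d t s] for [f] in [L1], a fortiori in [BL1]; for
   [f := u |-> c * d u s *: x] its absolute value is [c * d t s]. This settles the
   norms MK and MK*. For the norm H, the decomposition of [mu] with [nu = mu] gives
   the upper bound; conversely [f := u |-> (d u s / max (diam T) 1) *: x] lies in [L1]
   and has sup norm at most 1, so the absolute value of its integral against [mu] is
   at most [norm_MKstar nu + vnorm (mu - nu)] for every [nu]. Finally
   [vnorm (delta_t x - delta_s x) = 2] for [t <> s], and a compact discrete space is
   finite. *)

(** * The scalar field *)

Section scalars.
Context {R : realType} {k : scalar_kind}.
Local Notation K := (scalars R k).

(** Embedding of the reals into the scalars. It is injective and monotone, so estimates on the
    K-valued norms of the library pass through it to [norm]. *)
Definition of_real : R -> K :=
  match k return R -> scalars R k with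
  | RealScalars => idfun
  | ComplexScalars => fun r => Complex r 0
  end.

Lemma of_realK (r : R) : scal_re (of_real r) = r.
Proof. by rewrite /of_real /scal_re; case: (k). Qed.

Lemma of_real1 : of_real 1 = 1.
Proof. by rewrite /of_real; case: (k). Qed.

Lemma of_real0 : of_real 0 = 0.
Proof. by rewrite /of_real; case: (k). Qed.

Lemma of_realD r s : of_real (r + s) = of_real r + of_real s.
Proof. by rewrite /of_real; case: (k) => //; exact: (rmorphD (real_complex R)). Qed.

Lemma of_realB r s : of_real (r - s) = of_real r - of_real s.
Proof. by rewrite /of_real; case: (k) => //; exact: (rmorphB (real_complex R)). Qed.

Lemma of_realM r s : of_real (r * s) = of_real r * of_real s.
Proof. by rewrite /of_real; case: (k) => //; exact: (rmorphM (real_complex R)). Qed.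

Lemma of_real_le r s : (of_real r <= of_real s) = (r <= s).
Proof. by rewrite /of_real; case: (k) => //; exact: lecR. Qed.

Lemma of_real_lt r s : (of_real r < of_real s) = (r < s).
Proof. by rewrite /of_real; case: (k) => //; exact: ltcR. Qed.

Lemma scal_reK (z : K) : 0 <= z -> of_real (scal_re z) = z.
Proof.
rewrite /of_real /scal_re; case: (k) z => // z z0.
by have := RRe_real (ger0_real z0).
Qed.

Lemma of_real_norm (V : normedZmodType K) (v : V) : of_real (norm v) = `|v|.
Proof. exact: scal_reK. Qed.

Lemma norm_eq (V : normedZmodType K) (v : V) (r : R) :
  `|v| = of_real r -> norm v = r.
Proof. by rewrite /norm => ->; exact: of_realK. Qed.

Lemma norm_ge0 (V : normedZmodType K) (v : V) : 0 <= norm v.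
Proof. by rewrite -of_real_le of_real_norm of_real0. Qed.

Lemma norm_sym (V : normedZmodType K) (v : V) : norm (- v) = norm v.
Proof. by rewrite /norm normrN. Qed.

Lemma norm_subC (V : normedZmodType K) (v w : V) : norm (v - w) = norm (w - v).
Proof. by rewrite -norm_sym opprB. Qed.

Lemma norm_D (V : normedZmodType K) (v w : V) : norm (v + w) <= norm v + norm w.
Proof. by rewrite -of_real_le of_realD !of_real_norm ler_normD. Qed.

Lemma norm_B (V : normedZmodType K) (v w : V) : norm (v - w) <= norm v + norm w.
Proof. by rewrite -(norm_sym w) norm_D. Qed.

Lemma norm_0 (V : normedZmodType K) : norm (0 : V) = 0.
Proof. by apply: norm_eq; rewrite normr0 of_real0. Qed.

Lemma norm_Z (V : normedModType K) (a : K) (v : V) :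
  norm (a *: v) = norm (a : K^o) * norm v.
Proof. by apply: norm_eq; rewrite normrZ of_realM !of_real_norm. Qed.

Lemma norm_of_real (r : R) : norm (of_real r : K^o) = `|r|.
Proof.
apply: norm_eq; rewrite /of_real; case: (k) => //.
by rewrite [LHS]normc_def /= expr0n addr0 sqrtr_sqr.
Qed.

Lemma norm_ofrZ (V : normedModType K) (r : R) (v : V) :
  norm (of_real r *: v) = `|r| * norm v.
Proof. by rewrite norm_Z norm_of_real. Qed.

(** Convergence in [V] quantifies over positive [e] in K. Such an [e] is real, hence the image of
    [scal_re e], so real radii suffice. *)
Lemma norm_lim (V : normedModType K) (u : nat -> V) (l : V) :
  u @ \oo --> l <->
  forall e : R, 0 < e -> \forall n \near \oo, norm (l - u n) < e.
Proof.
split=> [/cvgrPdist_lt h e e0|h].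
  have := h (of_real e); rewrite -of_real0 of_real_lt => /(_ e0).
  by apply: filterS => n; rewrite -of_real_norm of_real_lt.
apply/cvgrPdist_lt => e e0.
have eE : of_real (scal_re e) = e by apply: scal_reK; exact: ltW.
have := h (scal_re e); rewrite -of_real_lt eE of_real0 => /(_ e0).
by apply: filterS => n; rewrite -of_real_lt of_real_norm eE.
Qed.

Lemma norm_conj (c : K) : c * scal_conj c = `|c| ^+ 2.
Proof.
rewrite /scal_conj; case: (k) c => c /=; last by rewrite [in RHS]sqr_normc.
by rewrite real_normK ?num_real.
Qed.

End scalars.

(** * Completeness of the scalars and uniform convergence *)

Lemma real_cauchy_cvg {R : realType} (u : nat -> R) :
  (forall e : R, 0 < e -> exists N, forall m n, (N <= m)%N -> (N <= n)%N ->
    `|u m - u n| < e) -> cvgn u.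
Proof.
move=> h; apply/cauchy_cvgP/cauchy_exP => e e0.
have [N hN] := h e e0; exists (u N); exists N => // n /= Nn.
by rewrite -ball_normE /=; apply: hN.
Qed.

(** In the complex case the real and imaginary parts are Cauchy, being bounded by the modulus; their
    limits are reassembled by the triangle inequality. *)
Lemma scal_cauchy_cvg {R : realType} {k : scalar_kind} (u : nat -> (scalars R k)^o) :
  (forall e : R, 0 < e -> exists N, forall m n, (N <= m)%N -> (N <= n)%N ->
    norm (u m - u n) < e) -> exists l : (scalars R k)^o, u @ \oo --> l.
Proof.
case: k u => u h.
  by have /cvg_ex[l ul] := @real_cauchy_cvg R u h; exists l.
have normRe (z : R[i]) : `|complex.Re z| <= norm (z : (scalars R ComplexScalars)^o).
  by have := normc_ge_Re z; rewrite lecE => /andP[_].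
have normIm (z : R[i]) : `|complex.Im z| <= norm (z : (scalars R ComplexScalars)^o).
  (* The imaginary part of [z] is, up to sign, the real part of [z * 'i], which has the same modulus
     as [z]. *)
  have := normc_ge_Re (z * 'i%C); rewrite ReiNIm normrN lecE => /andP[_] /le_trans; apply.
  rewrite normrM; suff -> : `|'i%C : R[i]| = 1 by rewrite mulr1.
  by rewrite normc_def /= expr0n add0r expr1n sqrtr1.
have ReB (z w : R[i]) : complex.Re (z - w) = complex.Re z - complex.Re w.
  by case: z w => [? ?] [? ?].
have ImB (z w : R[i]) : complex.Im (z - w) = complex.Im z - complex.Im w.
  by case: z w => [? ?] [? ?].
have /cvg_ex[a ua] : cvgn (fun n => complex.Re (u n)).
  apply: real_cauchy_cvg => e /h[N hN]; exists N => m n Nm Nn.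
  by rewrite /= -ReB (le_lt_trans (normRe _))// hN.
have /cvg_ex[b ub] : cvgn (fun n => complex.Im (u n)).
  apply: real_cauchy_cvg => e /h[N hN]; exists N => m n Nm Nn.
  by rewrite /= -ImB (le_lt_trans (normIm _))// hN.
exists (Complex a b); apply/norm_lim => e e0.
have e2 : 0 < e / 2 by rewrite divr_gt0.
move/cvgrPdist_lt: ua => /(_ _ e2); move/cvgrPdist_lt: ub => /(_ _ e2).
apply: filterS2 => n bn an.
rewrite [X in _ < X](splitr e).
set z : R[i] := Complex a b - u n.
have -> : norm (z : (scalars R ComplexScalars)^o) =
    norm ((complex.Re z)%:C%C + 'i%C * (complex.Im z)%:C%C : (scalars R ComplexScalars)^o).
  by rewrite -complexE.
apply: (le_lt_trans (norm_D _ _)); rewrite addrC ltrD//.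
  rewrite (_ : norm _ = `|complex.Im z|); first by rewrite ImB.
  apply: norm_eq; rewrite normrM.
  rewrite [X in X * _](_ : _ = 1) ?mul1r.
    by rewrite normc_def /= expr0n addr0 sqrtr_sqr.
  by rewrite normc_def /= expr0n add0r expr1n sqrtr1.
rewrite (_ : norm _ = `|complex.Re z|); first by rewrite ReB.
by apply: norm_eq; rewrite normc_def /= expr0n addr0 sqrtr_sqr.
Qed.

Lemma uniform_norm {R : realType} {k : scalar_kind} {T : choiceType}
    {V : normedModType (scalars R k)} (u : nat -> T -> V) (f : T -> V) :
  {uniform, u @ \oo --> f} <->
  forall e : R, 0 < e -> \forall n \near \oo, forall t, norm (f t - u n t) < e.
Proof.
split=> [h e e0|h P].
  have e0' : 0 < of_real e :> scalars R k by rewrite -of_real0 of_real_lt.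
  apply: (h [set g | forall t, norm (f t - g t) < e]); apply/uniform_nbhs.
  exists [set xy : V * V | ball xy.1 (of_real e) xy.2]; split.
    exact: entourage_ball (PosNum e0').
  by move=> g /= fg t; have := fg t I; rewrite -ball_normE /= -of_real_norm of_real_lt.
move=> /uniform_nbhs[E [entE EP]].
move: entE; rewrite -entourage_ballE => -[e /= e0 eE].
have eeE : of_real (scal_re e) = e by apply: scal_reK; exact: ltW.
have := h (scal_re e); rewrite -(@of_real_lt R k) eeE of_real0 => /(_ e0).
apply: filterS => n hn; apply: EP => t _; apply: eE => /=.
by rewrite -ball_normE /= -of_real_norm -eeE of_real_lt.
Qed.

(** * The scalar product and the Cauchy-Schwarz inequality *)

Section dot.
Context {R : realType} {k : scalar_kind}.
Local Notation K := (scalars R k).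
Variables (X : normedModType K) (dot : {dot X for @scal_conj R k}).
Hypothesis dot_norm : forall v : X, dot v v = `|v| ^+ 2.

Lemma dotC u v : dot u v = scal_conj (dot v u).
Proof. by rewrite [LHS]hermitian_subproof expr0 mul1r. Qed.

Lemma dotZl a u v : dot (a *: u) v = a * dot u v.
Proof. exact: linearZl_LR. Qed.

Lemma dotZr a u v : dot u (a *: v) = scal_conj a * dot u v.
Proof. exact: linearZr_LR. Qed.

Lemma dotBl u v w : dot (u - v) w = dot u w - dot v w.
Proof. exact: linearBl. Qed.

Lemma dotBr u v w : dot u (v - w) = dot u v - dot u w.
Proof. exact: linearBr. Qed.

Lemma dotDl u v w : dot (u + v) w = dot u w + dot v w.
Proof. exact: linearDl. Qed.

Lemma dotDr u v w : dot u (v + w) = dot u v + dot u w.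
Proof. exact: linearDr. Qed.

Lemma dot0r u : dot u 0 = 0.
Proof. exact: linear0r. Qed.

Lemma dot0l u : dot 0 u = 0.
Proof. exact: linear0l. Qed.

(** With [c = dot u v], the squared norm of [|v| ^+ 2 *: u - c *: v] expands to [|v| ^+ 2] times the
    difference of the squares of the two sides. *)
Lemma cauchy_schwarz u v : norm (dot u v : K^o) <= norm u * norm v.
Proof.
have [->|v0] := eqVneq v 0; first by rewrite dot0r !norm_0 mulr0.
rewrite -(@of_real_le R k) of_realM !of_real_norm.
set c := dot u v.
have nv0 : 0 < `|v| ^+ 2 by rewrite exprn_gt0// normr_gt0.
have conjn : scal_conj (`|v| ^+ 2) = `|v| ^+ 2.
  by rewrite -dot_norm -dotC.
have := exprn_ge0 2 (normr_ge0 (`|v| ^+ 2 *: u - c *: v)).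
rewrite -dot_norm dotBl !dotBr !dotZl !dotZr conjn (dotC v u) !dot_norm -/c.
have -> : `|v| ^+ 2 * (`|v| ^+ 2 * `|u| ^+ 2) - `|v| ^+ 2 * (scal_conj c * c)
    - (c * (`|v| ^+ 2 * scal_conj c) - c * (scal_conj c * `|v| ^+ 2))
  = `|v| ^+ 2 * ((`|u| * `|v|) ^+ 2 - `|c : K^o| ^+ 2).
  by rewrite -norm_conj; ring.
rewrite pmulr_rge0// subr_ge0 ler_pXn2r// nnegrE ?mulr_ge0//.
Qed.

End dot.

(** * Borel sets and variation *)

Section borel.
Context {R : realType} {T : metricType R}.
Implicit Types A B : set T.

Lemma borel0 : borel (set0 : set T).
Proof. exact: sigma_algebra0. Qed.

Lemma borelC A : borel A -> borel (~` A).
Proof. by move=> bA; rewrite -setTD; exact: (@sigma_algebraCD _ setT). Qed.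

Lemma borelT : borel [set: T].
Proof. by rewrite -setC0; apply: borelC; exact: borel0. Qed.

Lemma borelU A B : borel A -> borel B -> borel (A `|` B).
Proof.
move=> bA bB; rewrite -bigcup2E; apply: (@sigma_algebra_bigcup _ setT).
by case=> [|[|n]] //; exact: borel0.
Qed.

Lemma borelI A B : borel A -> borel B -> borel (A `&` B).
Proof.
move=> bA bB; rewrite -(setCK (A `&` B)) setCI; apply: borelC.
by apply: borelU; exact: borelC.
Qed.

Lemma borelD A B : borel A -> borel B -> borel (A `\` B).
Proof. by move=> bA bB; rewrite setDE; apply: borelI => //; exact: borelC. Qed.

Lemma borel_open A : open A -> borel A.
Proof. exact: sub_sigma_algebra. Qed.

Lemma borel_set1 (t : T) : borel [set t].
Proof.
rewrite -(setCK [set t]); apply: borelC; apply: borel_open; rewrite openC.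
apply: accessible_closed_set1; apply: hausdorff_accessible.
exact: metric_hausdorff.
Qed.

End borel.

Section variation.
Context {R : realType} {k : scalar_kind}.
Local Notation K := (scalars R k).
Context {T : metricType R} {X : completeNormedModType K}.
Implicit Types (mu nu : set T -> X) (A B : set T).

Definition finitely_additive nu := [/\ nu set0 = 0 &
  forall A B, borel A -> borel B -> A `&` B = set0 ->
    nu (A `|` B) = nu A + nu B].

(** For the constant sequence [set0], consecutive partial sums differ by [nu set0] and have the same
    limit, so [nu set0 = 0]. For the sequence [A], [B], [set0], [set0], ... the partial sums are
    then constant from index 2 on. *)
Lemma vsigma_additive_finitely nu : vsigma_additive nu -> finitely_additive nu.
Proof.
move=> snu.
have nu0 : nu set0 = 0.
  have tF : trivIset setT (fun _ : nat => set0 : set T).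
    by apply/trivIsetP => i j _ _ _; rewrite setI0.
  have h := snu _ (fun=> borel0) tF; rewrite bigcup0// in h.
  have h1 := h; rewrite -cvg_shiftS in h1.
  have E : (fun n => \sum_(0 <= i < n.+1) nu set0 - \sum_(0 <= i < n) nu set0)
      = cst (nu set0).
    by apply/funext => n /=; rewrite big_nat_recr//= addrAC subrr add0r.
  have : cst (nu set0) @ \oo --> nu set0 - nu set0 by rewrite -E; exact: cvgB h1 h.
  by rewrite subrr; apply: cvg_unique; [exact: norm_hausdorff|exact: cvg_cst].
split=> // A B bA bB AB.
pose F n := if n is n'.+1 then (if n' is 0 then B else set0) else A.
have UF : \bigcup_i F i = A `|` B.
  apply/seteqP; split=> t.
    by case=> -[|[|n]] _ //=; [left|right].
  by case=> ?; [exists 0|exists 1].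
have bF i : borel (F i) by case: i => [|[|i]] //; exact: borel0.
have tF : trivIset setT F.
  apply/trivIsetP => -[|[|i]] [|[|j]] _ _ _ //=; rewrite ?setI0 ?set0I//.
  by rewrite setIC.
have h := snu F bF tF; rewrite UF -(cvg_shiftn 2) in h.
rewrite (_ : (fun n => _) = cst (nu A + nu B)) in h.
  exact: (cvg_unique (@norm_hausdorff _ _) h (cvg_cst _)).
apply/funext => n; rewrite addn2 /= big_nat_recl// big_nat_recl//= big1 ?addr0//.
Qed.

(** The set whose supremum is [variation], kept in R so that estimates avoid the extended reals. *)
Definition partition_sums nu A : set R := [set v | exists n (F : nat -> set T),
  [/\ forall i, (i < n)%N -> borel (F i), trivIset `I_n F,
      \bigcup_(i < n) F i = A & v = \sum_(i < n) norm (nu (F i))]].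

Lemma variationE nu A : Defs.variation nu A = ereal_sup (EFin @` partition_sums nu A).
Proof.
congr ereal_sup; apply/seteqP; split=> v.
  by case=> n [F [bF tF FA ->]]; eexists; first by exists n, F; split.
by case=> _ [n [F [bF tF FA ->]]] <-; exists n, F.
Qed.

Lemma partition_sums1 nu A : borel A -> partition_sums nu A (norm (nu A)).
Proof.
move=> bA; exists 1%N, (fun=> A); split=> //.
- by apply/trivIsetP => -[|i] [|j].
- by apply/seteqP; split=> [t []//|t At]; exists 0.
- by rewrite big_ord1.
Qed.

(** Finiteness matters here because [vnorm] is defined by [fine], which sends [+oo] to 0. *)
Lemma partition_sums_le nu v : (Defs.variation nu setT < +oo)%E ->
  partition_sums nu setT v -> v <= vnorm nu.
Proof.
move=> fin nuv; rewrite -lee_fin /vnorm.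
have le1 : (v%:E <= Defs.variation nu setT)%E.
  by rewrite variationE; apply: ereal_sup_ubound; exists v.
by rewrite fineK// fin_numElt fin andbT (lt_le_trans _ le1)// ltNyr.
Qed.

Lemma variation_le nu (M : R) : (forall v, partition_sums nu setT v -> v <= M) ->
  (Defs.variation nu setT < +oo)%E /\ vnorm nu <= M.
Proof.
move=> h.
have le : (Defs.variation nu setT <= M%:E)%E.
  by rewrite variationE; apply: ge_ereal_sup => _ [v nuv <-]; rewrite lee_fin h.
have fin : (Defs.variation nu setT < +oo)%E by rewrite (le_lt_trans le)// ltry.
split=> //; rewrite -lee_fin /vnorm fineK// fin_numElt fin andbT.
(* The partition with the single piece T keeps the variation above [-oo]. *)
apply: (@lt_le_trans _ _ (norm (nu setT))%:E); first exact: ltNyr.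
rewrite variationE; apply: ereal_sup_ubound; exists (norm (nu setT)) => //.
exact: partition_sums1 borelT.
Qed.

Lemma vnorm_ge0 nu : (Defs.variation nu setT < +oo)%E -> 0 <= vnorm nu.
Proof.
move=> fin; apply: le_trans (partition_sums_le fin (partition_sums1 nu borelT)).
exact: norm_ge0.
Qed.

(** The two partitions are concatenated, the indices of the second being shifted by [n]; pieces from
    different partitions are disjoint because [A] and [B] are. *)
Lemma partition_sumsU nu A B v w : A `&` B = set0 ->
  partition_sums nu A v -> partition_sums nu B w ->
  partition_sums nu (A `|` B) (v + w).
Proof.
move=> AB [n [F [bF tF FA ->]]] [m [G [bG tG GB ->]]].
have subF i t : (i < n)%N -> F i t -> A t by move=> ni Fit; rewrite -FA; exists i.
have subG i t : (i < m)%N -> G i t -> B t by move=> ni Fit; rewrite -GB; exists i.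
have sub i : (i < n + m)%N -> ~~ (i < n)%N -> (i - n < m)%N by lia.
exists (n + m)%N, (fun i => if (i < n)%N then F i else G (i - n)%N); split.
- by move=> i inm; case: ifPn => [/bF//|/(sub _ inm) /bG].
- move=> i j /= inm jnm [t []].
  case: ifPn => [iln|iln]; case: ifPn => [jln|jln] Fi Fj.
  + by apply: tF => //; exists t.
  + have : (A `&` B) t by split; [exact: subF Fi|exact: subG (sub _ _ _) Fj].
    by rewrite AB.
  + have : (A `&` B) t by split; [exact: subF Fj|exact: subG (sub _ _ _) Fi].
    by rewrite AB.
  + have : (i - n = j - n)%N.
      by apply: tG; rewrite /= ?sub//; exists t.
    lia.
- apply/seteqP; split=> t.
    case=> i /= inm; case: ifPn => iln Fi; first by left; exact: subF Fi.
    by right; exact: subG (sub _ _ _) Fi.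
  case; [rewrite -FA|rewrite -GB] => -[i /= iln Fi].
    by exists i; rewrite /= ?iln//; lia.
  exists (n + i)%N => /=; first by rewrite ltn_add2l.
  by rewrite ltnNge leq_addr /= addKn.
- rewrite big_split_ord /=; congr (_ + _); apply: eq_bigr => i _.
    by rewrite ltn_ord.
  by rewrite ltnNge leq_addr /= addKn.
Qed.

End variation.

(** * Simple functions and the integral *)

Section simple.
Context {R : realType} {k : scalar_kind}.
Local Notation K := (scalars R k).
Context {T : metricType R} {X : completeNormedModType K}.
Implicit Types (mu nu : set T -> X) (A B : set T) (s : seq (set T * X)).

Definition borel_simple s := {in s, forall p, borel p.1}.

Lemma borel_simple_cons p s : borel_simple (p :: s) -> borel p.1 /\ borel_simple s.
Proof.
move=> h; split; first by apply: h; rewrite inE eqxx.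
by move=> q qs; apply: h; rewrite inE qs orbT.
Qed.

Lemma borel_simple_cat s1 s2 :
  borel_simple s1 -> borel_simple s2 -> borel_simple (s1 ++ s2).
Proof. by move=> h1 h2 p; rewrite mem_cat => /orP[/h1|/h2]. Qed.

(** Appending [simple_opp s'] to [s] represents the difference of the two simple functions. *)
Definition simple_opp s := [seq (p.1, - p.2) | p <- s].

Lemma borel_simple_opp s : borel_simple s -> borel_simple (simple_opp s).
Proof. by move=> h _ /mapP[p /h bp ->]. Qed.

Lemma simple_fun_nil t : simple_fun ([::] : seq (set T * X)) t = 0.
Proof. by rewrite /simple_fun big_nil. Qed.

Lemma simple_fun_cons p s t :
  simple_fun (p :: s) t = (\1_(p.1) t : K) *: p.2 + simple_fun s t.
Proof. by rewrite /simple_fun big_cons. Qed.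

Lemma simple_fun_cat s1 s2 t :
  simple_fun (s1 ++ s2) t = simple_fun s1 t + simple_fun s2 t.
Proof. by rewrite /simple_fun big_cat. Qed.

Lemma simple_fun_opp s t : simple_fun (simple_opp s) t = - simple_fun s t.
Proof.
by rewrite /simple_fun big_map -sumrN; apply: eq_bigr => p _; rewrite scalerN.
Qed.

Lemma indic1 A (t : T) : A t -> (\1_A t : K) = 1.
Proof. by move=> At; rewrite indicE mem_set. Qed.

Lemma indic0 A (t : T) : ~ A t -> (\1_A t : K) = 0.
Proof. by move=> At; rewrite indicE memNset. Qed.

Variable dot : {dot X for @scal_conj R k}.
Hypothesis dot_norm : forall v : X, dot v v = `|v| ^+ 2.

Lemma simple_int_cat nu s1 s2 :
  simple_int dot nu (s1 ++ s2) = simple_int dot nu s1 + simple_int dot nu s2.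
Proof. by rewrite /simple_int big_cat. Qed.

Lemma simple_int_opp nu s : simple_int dot nu (simple_opp s) = - simple_int dot nu s.
Proof.
rewrite /simple_int big_map -sumrN; apply: eq_bigr => p _ /=.
by rewrite -[- p.2]sub0r dotBl dot0l sub0r.
Qed.

Lemma simple_intB mu nu s :
  simple_int dot (mu - nu) s = simple_int dot mu s - simple_int dot nu s.
Proof.
rewrite /simple_int -sumrB; apply: eq_bigr => p _ /=.
by rewrite -dotBr.
Qed.

(* Splitting [B] along the sets of [s] one at a time yields a partition of [B]
   on the pieces of which [s] is constant. *)
Lemma simple_int_split nu s (C : R) : finitely_additive nu -> borel_simple s ->
  0 <= C -> forall B y, borel B ->
  (forall t, B t -> norm (y + simple_fun s t) <= C) ->
  exists2 v, partition_sums nu B v &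
    norm (dot y (nu B) + \sum_(p <- s) dot p.2 (nu (p.1 `&` B)) : K^o) <= C * v.
Proof.
move=> [nu0 nuU] bs C0; elim: s bs => [|[A x] s IH] bs B y bB hB.
  exists (norm (nu B)); first exact: partition_sums1.
  rewrite big_nil addr0 (le_trans (cauchy_schwarz dot_norm _ _))//.
  (* On an empty [B] the hypothesis says nothing about [y], but then [nu B] vanishes. *)
  have [->|/set0P[t Bt]] := eqVneq B set0; first by rewrite nu0 norm_0 !mulr0.
  rewrite ler_wpM2r ?norm_ge0//.
  by have := hB t Bt; rewrite simple_fun_nil addr0.
have [/= bA bs'] := borel_simple_cons bs; have {}IH := IH bs'.
(* The vector [y] accumulates the terms already treated, which are constant on [B]: the head
   [(A, x)] adds [x] to it on the part inside [A] and nothing on the part outside. *)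
have [t|v1 nuv1 h1] := IH (B `&` A) (y + x) (borelI bB bA).
  move=> [/hB + At]; rewrite simple_fun_cons /= indic1// scale1r addrA.
  exact.
have [t|v2 nuv2 h2] := IH (B `\` A) y (borelD bB bA).
  by move=> [/hB + At]; rewrite simple_fun_cons /= indic0// scale0r add0r.
have dis : (B `&` A) `&` (B `\` A) = set0.
  by apply/seteqP; split=> t // [[_ At] [_ /(_ At)]].
have split_nu D : borel D -> nu (D `&` B) = nu (D `&` (B `&` A)) + nu (D `&` (B `\` A)).
  move=> bD; rewrite -nuU.
  - by rewrite -setIUr -{1}(setUIDK B A).
  - by apply: borelI => //; exact: borelI.
  - by apply: borelI => //; exact: borelD.
  - by rewrite setIACA dis setI0.
exists (v1 + v2).
  by have := partition_sumsU dis nuv1 nuv2; rewrite setUIDK.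
rewrite mulrDr; apply: le_trans (lerD h1 h2); apply: le_trans (norm_D _ _).
rewrite le_eqVlt; apply/orP; left; apply/eqP; congr norm.
rewrite big_cons /= (setIC A B).
have -> : \sum_(p <- s) dot p.2 (nu (p.1 `&` B)) =
    \sum_(p <- s) dot p.2 (nu (p.1 `&` (B `&` A))) +
    \sum_(p <- s) dot p.2 (nu (p.1 `&` (B `\` A))).
  rewrite -big_split; apply: eq_big_seq => p ps /=.
  by rewrite (split_nu p.1 (bs' p ps)) dotDr.
have nuB := split_nu setT borelT; rewrite !setTI in nuB.
rewrite nuB dotDr dotDl; ring.
Qed.

(** The sets of [s] may overlap, so the bound is read off from a partition on whose pieces [s] is
    constant: [simple_int_split] with [B = setT] and [y = 0]. *)
Lemma simple_int_le nu s (C : R) : finitely_additive nu ->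
  (Defs.variation nu setT < +oo)%E -> borel_simple s ->
  0 <= C -> (forall t, norm (simple_fun s t) <= C) ->
  norm (simple_int dot nu s : K^o) <= C * vnorm nu.
Proof.
move=> anu fin bs C0 h.
have [t _|v nuv] := simple_int_split anu bs C0 (y := 0) borelT.
  by rewrite add0r.
rewrite dot0l add0r; under eq_bigr do rewrite setIT.
move=> /le_trans; apply; rewrite ler_wpM2l//.
exact: partition_sums_le.
Qed.

End simple.

(** * Uniform approximation of Lipschitz functions by simple functions *)

Section approximation.
Context {R : realType} {k : scalar_kind}.
Local Notation K := (scalars R k).
Context {T : metricType R} {X : completeNormedModType K}.

Lemma mdist_ball_open (c : T) (r : R) : open [set t | mdist c t < r].
Proof.
have : @metric_open R T mdist [set t | mdist c t < r].
  move=> t /= ct; exists (r - mdist c t); first by rewrite subr_gt0.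
  move=> u /= tu; apply: le_lt_trans (metric_triangle _ t _) _.
  by rewrite addrC -ltrBrDr.
by rewrite metric_open_mdist.
Qed.

Lemma compact_subcover (F : T -> set T) : compact [set: T] ->
  (forall c, open (F c)) -> (forall t, F t t) ->
  exists cs : seq T, forall t, exists2 c, c \in cs & F c t.
Proof.
move=> cT oF Ft.
have [[t0]|T0] := pselect (inhabited T); last first.
  by exists [::] => t; case: T0; exists.
(* [compact_cover] is stated for pointed types only. *)
pose T' : ptopologicalType := HB.pack (T : Type) (isPointed.Build T t0) T.
have {}cT : @cover_compact T' setT by rewrite -compact_cover.
have [//|t _|D _ TD] := cT T setT F; first by exists t.
exists (finmap.enum_fset D) => t.
by have [c cD ct] := TD t I; exists c.
Qed.

Lemma compact_net (r : R) : compact [set: T] -> 0 < r ->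
  exists cs : seq T, forall t, exists2 c, c \in cs & mdist c t < r.
Proof.
move=> cT r0; apply: (compact_subcover cT (fun c => mdist_ball_open c r)) => t /=.
by rewrite mdistxx.
Qed.

(** The approximation takes the value [f c] on a small ball around each centre [c] of a finite net.
    Balls are added one at a time and cut out of the sets already present, so that at each point a
    single value counts. *)
Lemma simple_approx (f : T -> X) (e : R) : compact [set: T] -> lip f -> 0 < e ->
  exists2 s, borel_simple s & forall t, norm (f t - simple_fun s t) < e.
Proof.
move=> cT [L [L0 fL]] e0.
(* The radius is taken with [L + 1] since [L] may be 0. *)
have r0 : 0 < e / (L + 1) by rewrite divr_gt0// ltr_wpDl.
have [cs hcs] := compact_net cT r0.
(* For the induction on [cs], the estimate is asked for only at the points covered by the balls. *)
suff [s bs hs] : exists2 s : seq (set T * X), borel_simple s & forall t,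
    (exists2 c, c \in cs & mdist c t < e / (L + 1)) -> norm (f t - simple_fun s t) < e.
  by exists s => // t; exact: hs.
elim: cs {hcs} => [|c cs [s bs hs]]; first by exists [::] => // t [].
pose B := [set t | mdist c t < e / (L + 1)].
have bB : borel B by apply: borel_open; exact: mdist_ball_open.
exists ((B, f c) :: [seq (p.1 `\` B, p.2) | p <- s]).
  move=> p; rewrite inE => /predU1P[->//|/mapP[q qs ->]] /=.
  by apply: borelD => //; exact: bs.
move=> t ct; rewrite simple_fun_cons /=.
have [Bt|Bt] := pselect (B t).
  rewrite indic1// scale1r /simple_fun big_map big1 ?addr0; last first.
    by move=> p _ /=; rewrite indic0 ?scale0r// => -[].
  rewrite norm_subC (le_lt_trans (fL _ _))//.
  apply: (@le_lt_trans _ _ ((L + 1) * mdist c t)).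
    by rewrite ler_wpM2r ?mdist_ge0// lerDl.
  by rewrite mulrC -ltr_pdivlMr// ltr_wpDl.
rewrite indic0// scale0r add0r.
rewrite (_ : simple_fun _ t = simple_fun s t).
  by apply: hs; case: ct => c'; rewrite inE => /predU1P[-> /Bt//|c's ct]; exists c'.
rewrite /simple_fun big_map; apply: eq_bigr => p _ /=; congr (_ *: _).
have [pt|pt] := pselect (p.1 t); first by rewrite !indic1.
by rewrite !indic0// => -[].
Qed.

End approximation.

(** * Convergence and estimates of the integral *)

Section integral.
Context {R : realType} {k : scalar_kind}.
Local Notation K := (scalars R k).
Context {T : metricType R} {X : completeNormedModType K}.
Implicit Types (mu nu : set T -> X) (f : T -> X).

Definition approximates (s_ : nat -> seq (set T * X)) f :=
  (forall n, borel_simple (s_ n)) /\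
  forall e : R, 0 < e -> \forall n \near \oo, forall t, norm (f t - simple_fun (s_ n) t) < e.

Definition bounded_additive nu :=
  finitely_additive nu /\ (Defs.variation nu setT < +oo)%E.

Lemma cabv_bounded_additive nu : cabv nu -> bounded_additive nu.
Proof. by move=> [/vsigma_additive_finitely]. Qed.

Lemma approximates_exists f : compact [set: T] -> lip f ->
  exists s_ : nat -> seq (set T * X), approximates s_ f.
Proof.
move=> cT lf.
have /choice[s_ hs] : forall n : nat, exists s : seq (set T * X), borel_simple s /\
    forall t, norm (f t - simple_fun s t) < n.+1%:R^-1.
  move=> n; have n0 : (0 : R) < n.+1%:R^-1 by rewrite invr_gt0.
  by have [s bs fs] := simple_approx cT lf n0; exists s.
exists s_; split=> [n|e e0]; first by have [] := hs n.
near=> n => t; have [_ /(_ t) /lt_trans] := hs n; apply.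
by near: n; exact: near_infty_natSinv_lt (PosNum e0).
Unshelve. all: by end_near. Qed.

Variable dot : {dot X for @scal_conj R k}.
Hypothesis dot_norm : forall v : X, dot v v = `|v| ^+ 2.

Local Notation int mu s := (simple_int dot mu s : K^o).

Lemma simple_int_dist nu s s' (C : R) : bounded_additive nu ->
  borel_simple s -> borel_simple s' -> 0 <= C ->
  (forall t, norm (simple_fun s t - simple_fun s' t) <= C) ->
  norm (int nu s - int nu s') <= C * vnorm nu.
Proof.
move=> [anu fin] bs bs' C0 h.
rewrite -simple_int_opp -simple_int_cat; apply: simple_int_le => //.
  by apply: borel_simple_cat => //; exact: borel_simple_opp.
by move=> t; rewrite simple_fun_cat simple_fun_opp.
Qed.

(** Applied to one sequence twice, this is the Cauchy property of the integrals; applied to two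
    sequences, it shows that their limits agree. *)
Lemma simple_int_close nu f s_ s'_ : bounded_additive nu ->
  approximates s_ f -> approximates s'_ f -> forall e : R, 0 < e ->
  exists N, forall m n, (N <= m)%N -> (N <= n)%N ->
    norm (int nu (s_ m) - int nu (s'_ n)) < e.
Proof.
move=> banu [bs sf] [bs' sf'] e e0.
have V0 := vnorm_ge0 banu.2.
(* Each sequence contributes an error [d], and [2 * d * vnorm nu] stays below [e], even if
   [vnorm nu] is 0. *)
pose d : R := e / (vnorm nu + 1) / 2.
have d0 : 0 < d by rewrite !divr_gt0// ltr_wpDl.
have [N1 _ h1] := sf d d0; have [N2 _ h2] := sf' d d0.
exists (maxn N1 N2) => m n; rewrite !geq_max => /andP[m1 _] /andP[_ n2].
apply: (@le_lt_trans _ _ (d *+ 2 * vnorm nu)).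
  apply: simple_int_dist => //; first by rewrite mulrn_wge0// ltW.
  move=> t; rewrite -(subrKA (f t)) mulr2n (le_trans (norm_D _ _))// lerD//.
    by rewrite norm_subC ltW// h1.
  by rewrite ltW// h2.
rewrite /d mulr2n -splitr mulrAC ltr_pdivrMr ?ltr_wpDl//.
by rewrite ltr_pM2l// ltrDl.
Qed.

(** The value chosen by [xget] is the limit along some sequence [s'_]. Completeness of the scalars
    shows that a limit exists to choose, and [simple_int_close] carries the limit over from [s'_] to
    the given [s_]. *)
Lemma vint_cvg nu f s_ : bounded_additive nu -> approximates s_ f ->
  (fun n => int nu (s_ n)) @ \oo --> (vint dot nu f : K^o).
Proof.
move=> banu sf.
have [l sl] := scal_cauchy_cvg (simple_int_close banu sf sf).
pose P := [set l : K | exists s_ : nat -> seq (set T * X),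
    [/\ forall n, {in s_ n, forall p, borel p.1},
        {uniform, (fun n => simple_fun (s_ n)) @ \oo --> f} &
        (fun n => simple_int dot nu (s_ n)) @ \oo --> l]].
have [s'_ [bs' sf' sl']] : P (vint dot nu f).
  apply: (@xgetPex _ 0 P); exists l, s_; split=> //; first exact: sf.1.
  by apply/uniform_norm; exact: sf.2.
apply/norm_lim => e e0.
have e2 : 0 < e / 2 by rewrite divr_gt0.
have as' : approximates s'_ f by split=> //; apply/uniform_norm.
have [N hN] := simple_int_close banu as' sf e2.
have := (@norm_lim R k K^o _ _).1 sl' _ e2.
apply: filter_app; exists N => // n /= Nn h.
rewrite -(subrKA (int nu (s'_ n))) (splitr e) (le_lt_trans (norm_D _ _))//.
by rewrite ltrD// hN.
Qed.

Lemma vintB mu nu f : compact [set: T] -> lip f -> bounded_additive mu ->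
  bounded_additive nu -> bounded_additive (mu - nu) ->
  vint dot (mu - nu) f = vint dot mu f - vint dot nu f.
Proof.
move=> cT lf bmu bnu bmn; have [s_ sf] := approximates_exists cT lf.
apply: (cvg_unique (@norm_hausdorff _ K^o) (vint_cvg bmn sf)).
rewrite (_ : (fun n => _) = (fun n => int mu (s_ n)) - (fun n => int nu (s_ n))); last first.
  by apply/funext => n; exact: simple_intB.
by apply: cvgB; exact: vint_cvg.
Qed.

(** Comparison with the constant function [c]. The case [c = 0] bounds the integral by the sup norm;
    for a measure of total mass 0 the subtracted term vanishes, and the distance of [f] to any
    constant bounds the integral. *)
Lemma vint_le nu f c (C : R) : compact [set: T] -> lip f -> bounded_additive nu ->
  0 <= C -> (forall t, norm (f t - c) <= C) ->
  norm (vint dot nu f - dot c (nu setT) : K^o) <= C * vnorm nu.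
Proof.
move=> cT lf bnu C0 h; have [s_ sf] := approximates_exists cT lf.
have V0 := vnorm_ge0 bnu.2.
apply/ler_addgt0Pr => e e0.
(* The error is [d] from the limit of the integrals plus [d * vnorm nu] from the uniform
   approximation, which add up to [e]. *)
pose d := e / (vnorm nu + 1).
have d0 : 0 < d by rewrite divr_gt0// ltr_wpDl.
have [N1 _ h1] := (norm_lim _ _).1 (vint_cvg bnu sf) _ d0.
have [N2 _ h2] := sf.2 _ d0.
pose n := maxn N1 N2.
have {}h1 := h1 n (leq_maxl _ _); have {}h2 := h2 n (leq_maxr _ _).
pose cst_c : seq (set T * X) := [:: (setT, c)].
have bc : borel_simple cst_c.
  by move=> p; rewrite inE => /eqP ->; exact: borelT.
have intc : int nu cst_c = dot c (nu setT) by rewrite /simple_int big_seq1.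
have : norm (int nu (s_ n) - int nu cst_c) <= (C + d) * vnorm nu.
  apply: simple_int_dist => //; first exact: sf.1.
    by rewrite addr_ge0// ltW.
  move=> t; rewrite {2}/simple_fun big_seq1 /= indic1// scale1r.
  rewrite -(subrKA (f t)) addrC (le_trans (norm_D _ _))// lerD//.
  by rewrite norm_subC ltW.
rewrite intc => h3; rewrite -(subrKA (int nu (s_ n))).
apply: le_trans (norm_D _ _) _.
have -> : e = d * (vnorm nu + 1) by rewrite divfK// gt_eqF// ltr_wpDl.
by move: h1 h3 => /=; lra.
Qed.

End integral.

(** * Dirac measures *)

Section dirac.
Context {R : realType} {k : scalar_kind}.
Local Notation K := (scalars R k).
Context {T : metricType R} {X : completeNormedModType K}.
Implicit Types (mu nu : set T -> X) (A B : set T) (t : T).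

Lemma sub_measureE mu nu A : (mu - nu) A = mu A - nu A.
Proof. by []. Qed.

Lemma vsigma_additiveB mu nu :
  vsigma_additive mu -> vsigma_additive nu -> vsigma_additive (mu - nu).
Proof.
move=> smu snu F bF tF.
rewrite (_ : (fun n => _) = (fun n => \sum_(0 <= i < n) mu (F i)) -
    (fun n => \sum_(0 <= i < n) nu (F i))).
  exact: cvgB (smu F bF tF) (snu F bF tF).
by apply/funext => n; exact: sumrB.
Qed.

Lemma partition_sumsB_le mu nu (M N : R) :
  (forall v, partition_sums mu setT v -> v <= M) ->
  (forall v, partition_sums nu setT v -> v <= N) ->
  forall v, partition_sums (mu - nu) setT v -> v <= M + N.
Proof.
move=> hM hN _ [n [F [bF tF FT ->]]].
have h1 : \sum_(i < n) norm (mu (F i)) <= M by apply: hM; exists n, F.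
have h2 : \sum_(i < n) norm (nu (F i)) <= N by apply: hN; exists n, F.
apply: le_trans (lerD h1 h2); rewrite -big_split /=.
by apply: ler_sum => i _; exact: norm_B.
Qed.

Lemma vnormB_le mu nu : cabv mu -> cabv nu ->
  cabv (mu - nu) /\ vnorm (mu - nu) <= vnorm mu + vnorm nu.
Proof.
move=> [smu fmu] [snu fnu].
have [fin le] := variation_le (partition_sumsB_le
  (fun v => @partition_sums_le _ _ _ _ mu v fmu)
  (fun v => @partition_sums_le _ _ _ _ nu v fnu)).
by split=> //; split=> //; exact: vsigma_additiveB.
Qed.

Lemma cabvB mu nu : cabv mu -> cabv nu -> cabv (mu - nu).
Proof. by move=> cmu cnu; have [] := vnormB_le cmu cnu. Qed.

Variable x : X.

Lemma vdirac1 t A : A t -> vdirac t x A = x.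
Proof. by move=> At; rewrite /vdirac indic1// scale1r. Qed.

Lemma vdirac0 t A : ~ A t -> vdirac t x A = 0.
Proof. by move=> At; rewrite /vdirac indic0// scale0r. Qed.

(** At most one [F i] contains [t], so the partial sums are constant after index [i], or all
    zero. *)
Lemma vdirac_sigma_additive t : vsigma_additive (vdirac t x).
Proof.
move=> F bF tF.
have [[i _ Fit]|nF] := pselect ((\bigcup_i F i) t); last first.
  rewrite vdirac0// (_ : (fun n => _) = cst 0); first exact: cvg_cst.
  apply/funext => n; rewrite big1// => i _; rewrite vdirac0// => Fit.
  by apply: nF; exists i.
rewrite vdirac1; last by exists i.
rewrite -(cvg_shiftn i.+1) (_ : (fun n => _) = cst x); first exact: cvg_cst.
apply/funext => n /=; rewrite (bigD1_seq i) /= ?iota_uniq//; last first.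
  by rewrite mem_index_iota /= ltn_addl.
rewrite vdirac1// big1 ?addr0// => j /eqP ji; rewrite vdirac0// => Fjt.
by apply: ji; apply: tF => //; exists t.
Qed.

Lemma vdirac_partition_sums t v : partition_sums (vdirac t x) setT v -> v <= norm x.
Proof.
move=> [n [F [bF tF FT ->]]].
have [i /= i_n Fit] : (\bigcup_(i < n) F i) t by rewrite FT.
rewrite (bigD1 (Ordinal i_n)) //= vdirac1// big1 ?addr0// => j ji.
rewrite vdirac0 ?norm_0// => Fjt; move/eqP: ji; apply; apply/val_inj => /=.
by apply: tF => //=; exists t.
Qed.

Lemma vdirac_cabv t : cabv (vdirac t x) /\ vnorm (vdirac t x) <= norm x.
Proof.
have [fin le] := variation_le (@vdirac_partition_sums t).
by split=> //; split=> //; exact: vdirac_sigma_additive.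
Qed.

Lemma vdiracB_cabv0 t (s : T) : cabv0 (vdirac t x - vdirac s x).
Proof.
split; first exact: cabvB (vdirac_cabv t).1 (vdirac_cabv s).1.
by rewrite sub_measureE !vdirac1// subrr.
Qed.

Lemma vnorm0 : vnorm (0 : set T -> X) = 0.
Proof.
have [fin le] : (Defs.variation (0%R : set T -> X) setT < +oo)%E /\
    vnorm (0 : set T -> X) <= 0.
  apply: variation_le => v [n [F [_ _ _ ->]]].
  by rewrite big1// => i _; exact: norm_0.
by apply/eqP; rewrite eq_le le vnorm_ge0.
Qed.

(** The partition of T into [[set t]] and its complement attains the upper bound given by the
    triangle inequality. *)
Lemma vnorm_vdiracB t (s : T) : t <> s ->
  vnorm (vdirac t x - vdirac s x) = norm x + norm x.
Proof.
move=> ts.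
have [ct lt] := vdirac_cabv t; have [cs ls] := vdirac_cabv s.
have [[_ fin] le] := vnormB_le ct cs.
apply/eqP; rewrite eq_le (le_trans le) ?lerD//=.
have b1 := borel_set1 t.
have dis : [set t] `&` ~` [set t] = set0 by rewrite setICr.
have := partition_sumsU dis
  (partition_sums1 (vdirac t x - vdirac s x) b1)
  (partition_sums1 (vdirac t x - vdirac s x) (borelC b1)).
rewrite setUCr => /(partition_sums_le fin); apply: le_trans.
rewrite !sub_measureE (@vdirac1 t)// (@vdirac0 s); last by move=> /= /esym.
rewrite (@vdirac0 t); last by move=> /=.
rewrite (@vdirac1 s); last by move=> /= /esym.
by rewrite subr0 sub0r norm_sym.
Qed.

Variable dot : {dot X for @scal_conj R k}.
Hypothesis dot_norm : forall v : X, dot v v = `|v| ^+ 2.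

Lemma simple_int_vdirac t (s : seq (set T * X)) :
  simple_int dot (vdirac t x) s = dot (simple_fun s t) x.
Proof.
elim: s => [|p s IH]; first by rewrite simple_fun_nil dot0l /simple_int big_nil.
rewrite simple_fun_cons dotDl -IH /simple_int big_cons; congr (_ + _).
have [pt|pt] := pselect (p.1 t); first by rewrite vdirac1// indic1// scale1r.
by rewrite vdirac0// indic0// scale0r dot0r dot0l.
Qed.

(** For a simple function the integral is the scalar product of its value at [t] with [x];
    Cauchy-Schwarz allows passing to the limit. *)
Lemma vint_vdirac t f : compact [set: T] -> lip f ->
  vint dot (vdirac t x) f = dot (f t) x.
Proof.
move=> cT lf; have [s_ sf] := approximates_exists cT lf.
have ba := cabv_bounded_additive (vdirac_cabv t).1.
apply: (cvg_unique (@norm_hausdorff _ K^o) (vint_cvg dot_norm ba sf)).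
apply/norm_lim => e e0.
have d0 : 0 < e / (norm x + 1) by rewrite divr_gt0// ltr_wpDl// norm_ge0.
have := sf.2 _ d0; apply: filterS => n h.
rewrite simple_int_vdirac -dotBl (le_lt_trans (cauchy_schwarz dot_norm _ _))//.
apply: (@le_lt_trans _ _ (e / (norm x + 1) * norm x)).
  by rewrite ler_wpM2r ?norm_ge0// ltW.
rewrite mulrAC ltr_pdivrMr ?ltr_wpDl ?norm_ge0//.
by rewrite ltr_pM2l// ltrDl.
Qed.

Lemma vint_vdiracB t s f : compact [set: T] -> lip f ->
  vint dot (vdirac t x - vdirac s x) f = dot (f t - f s) x.
Proof.
move=> cT lf; rewrite vintB ?vint_vdirac ?dotBl//; apply: cabv_bounded_additive.
- by have [] := vdirac_cabv t.
- by have [] := vdirac_cabv s.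
- by have [] := vdiracB_cabv0 t s.
Qed.

End dirac.

(** * The norms MK, MK* and H *)

Section lipschitz.
Context {R : realType} {k : scalar_kind}.
Local Notation K := (scalars R k).
Context {T : metricType R} {X : completeNormedModType K}.
Implicit Types (f : T -> X) (t s : T).

(** The point is that the distances are bounded, so that [sup] is a genuine supremum. With a finite
    net of radius 1, the sum [M] of the distances from [t] to its centres exceeds each of them, and
    every point is within [M + 1] of [t]. *)
Lemma mdist_diam t s : compact [set: T] -> mdist t s <= diam T.
Proof.
move=> cT; have [cs hcs] := compact_net cT (@ltr01 R).
apply: ub_le_sup; last by exists t, s.
pose M : R := \sum_(c <- cs) mdist t c.
have tM u : mdist t u <= M + 1.
  have [c ccs cu] := hcs u.
  apply: le_trans (metric_triangle t c u) _; rewrite lerD ?(ltW cu)//.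
  by rewrite /M (big_rem c)//= lerDl; apply: sumr_ge0 => *; exact: mdist_ge0.
exists (M + 1 + (M + 1)) => _ [u [v ->]].
apply: le_trans (metric_triangle u t v) _.
by rewrite lerD// metric_sym.
Qed.

Lemma diam_ge0 : compact [set: T] -> (exists t : T, True) -> 0 <= diam T.
Proof. by move=> cT [t _]; apply: le_trans (mdist_diam t t cT); exact: mdist_ge0. Qed.

Lemma norm_L_le f (L : R) : lip_bound f L -> norm_L f <= L.
Proof. by move=> fL; apply: ge_inf => //; exists 0 => y []. Qed.

(** The infimum is attained: for distinct points the difference quotient is a lower bound of
    [lip_bound f]. *)
Lemma lip_norm_L f t s : lip f -> norm (f t - f s) <= norm_L f * mdist t s.
Proof.
move=> lf; have [->|ts] := eqVneq t s; first by rewrite mdistxx subrr norm_0 mulr0.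
have d0 : 0 < mdist t s by rewrite mdist_gt0.
rewrite -ler_pdivrMr//; apply: lb_le_inf => // L [L0 fL].
by rewrite ler_pdivrMr.
Qed.

Lemma norm_sup_le f (C : R) : (exists t : T, True) -> (forall t, norm (f t) <= C) ->
  norm_sup f <= C.
Proof.
move=> [t _] h; apply: ge_sup; first by exists (norm (f t)), t.
by move=> _ [u _ <-].
Qed.

Lemma norm_sup_ge0 f : (exists t : T, True) -> 0 <= norm_sup f.
Proof.
move=> [t _]; rewrite /norm_sup; set S := (X in sup X).
(* [sup] takes the default value 0 on a set without supremum. *)
have [hS|hS] := pselect (has_sup S); last by rewrite sup_out.
apply: le_trans (norm_ge0 (f t)) _.
by apply: ub_le_sup; [exact: hS.2|exists t].
Qed.

Lemma lip0 : lip_bound (fun _ : T => 0 : X) 0.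
Proof. by split=> // t s; rewrite subrr norm_0 mul0r. Qed.

Lemma BL1_0 : (exists t : T, True) -> BL1 (fun _ : T => 0 : X).
Proof.
move=> T0; split; first by exists 0; exact: lip0.
rewrite /norm_BL (le_trans (lerD (norm_sup_le T0 (C := 0) _) (norm_L_le lip0)))//.
by move=> t; rewrite norm_0.
Qed.

Lemma BL1_L1 f : (exists t : T, True) -> BL1 f -> L1 f.
Proof.
move=> T0 [lf f1]; split=> //; apply: le_trans f1.
by rewrite /norm_BL lerDr norm_sup_ge0.
Qed.

Lemma L1_0 : (exists t : T, True) -> L1 (fun _ : T => 0 : X).
Proof. by move=> T0; apply: BL1_L1 => //; exact: BL1_0. Qed.

Lemma L1_dist f t s : L1 f -> norm (f t - f s) <= mdist t s.
Proof.
move=> [lf f1]; apply: le_trans (lip_norm_L _ _ lf) _.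
by rewrite ler_piMl ?mdist_ge0.
Qed.

(* The lower bounds are tested on these functions. *)
Definition dist_fun (c : R) s (x : X) : T -> X := fun u => of_real (c * mdist u s) *: x.

Lemma dist_fun_lip (c : R) s (x : X) : 0 <= c -> norm x = 1 ->
  lip_bound (dist_fun c s x) c.
Proof.
move=> c0 x1; split=> // u v.
rewrite /dist_fun -scalerBl -of_realB norm_ofrZ x1 mulr1 -mulrBr normrM ger0_norm//.
rewrite ler_wpM2l// ler_norml; apply/andP; split.
  have := metric_triangle v u s; rewrite (metric_sym v u); lra.
have := metric_triangle u v s; lra.
Qed.

Lemma dist_fun_norm (c : R) s (x : X) u : 0 <= c -> norm x = 1 ->
  norm (dist_fun c s x u) = c * mdist u s.
Proof.
move=> c0 x1; rewrite /dist_fun norm_ofrZ x1 mulr1 ger0_norm//.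
by rewrite mulr_ge0// mdist_ge0.
Qed.

End lipschitz.

Section norms.
Context {R : realType} {k : scalar_kind}.
Local Notation K := (scalars R k).
Context {T : metricType R} {X : completeNormedModType K}.
Hypothesis T_compact : compact [set: T].
Hypothesis T_inhabited : exists t : T, True.
Variable dot : {dot X for @scal_conj R k}.
Hypothesis dot_norm : forall v : X, dot v v = `|v| ^+ 2.
Implicit Types (mu nu : set T -> X) (f : T -> X) (t s u : T).

(** Since [nu] has total mass 0, the constant [f t0] can be subtracted from [f], and what remains
    has norm at most [diam T]. This makes the suprema defining the norms MK and MK* finite on
    [cabv0]. *)
Lemma L1_vint_le nu f : cabv0 nu -> L1 f ->
  norm (vint dot nu f : K^o) <= diam T * vnorm nu.
Proof.
move=> [cnu nuT] f1; have [t0 _] := T_inhabited.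
have := @vint_le _ _ _ _ dot dot_norm nu f (f t0) (diam T) T_compact f1.1
  (cabv_bounded_additive cnu) (diam_ge0 T_compact T_inhabited).
rewrite nuT dot0r subr0; apply => t.
exact: le_trans (L1_dist _ _ f1) (mdist_diam _ _ T_compact).
Qed.

Lemma norm_MKstar_ub nu f : cabv0 nu -> L1 f ->
  norm (vint dot nu f : K^o) <= norm_MKstar dot nu.
Proof.
move=> cnu f1; apply: ub_le_sup; last by exists f.
by exists (diam T * vnorm nu) => _ [g g1 <-]; exact: L1_vint_le.
Qed.

Lemma norm_MKstar_le nu (M : R) :
  (forall f, L1 f -> norm (vint dot nu f : K^o) <= M) -> norm_MKstar dot nu <= M.
Proof.
move=> h; apply: ge_sup; last by move=> _ [f f1 <-]; exact: h.
by eexists; exists (fun=> 0); first exact: L1_0.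
Qed.

Lemma norm_MKstar_ge0 nu : cabv0 nu -> 0 <= norm_MKstar dot nu.
Proof.
move=> cnu; apply: le_trans (norm_MKstar_ub cnu (L1_0 T_inhabited)).
exact: norm_ge0.
Qed.

Lemma norm_MK_ub nu f : cabv0 nu -> BL1 f ->
  norm (vint dot nu f : K^o) <= norm_MK dot nu.
Proof.
move=> cnu f1; apply: ub_le_sup; last by exists f.
exists (diam T * vnorm nu) => _ [g g1 <-]; apply: L1_vint_le => //.
exact: BL1_L1.
Qed.

Lemma norm_MK_le nu (M : R) :
  (forall f, BL1 f -> norm (vint dot nu f : K^o) <= M) -> norm_MK dot nu <= M.
Proof.
move=> h; apply: ge_sup; last by move=> _ [f f1 <-]; exact: h.
by eexists; exists (fun=> 0); first exact: BL1_0.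
Qed.

Lemma cabv0B mu nu : cabv0 mu -> cabv0 nu -> cabv0 (mu - nu).
Proof.
move=> [cmu muT] [cnu nuT]; split; first exact: cabvB.
by rewrite sub_measureE muT nuT subrr.
Qed.

Lemma norm_vintB_le mu nu f : cabv mu -> cabv nu -> lip f ->
  norm (vint dot (mu - nu) f : K^o) <=
  norm (vint dot mu f : K^o) + norm (vint dot nu f : K^o).
Proof.
move=> cmu cnu lf; rewrite vintB ?norm_B//; apply: cabv_bounded_additive => //.
exact: cabvB.
Qed.

Lemma norm_MKstarB mu nu : cabv0 mu -> cabv0 nu ->
  norm_MKstar dot (mu - nu) <= norm_MKstar dot mu + norm_MKstar dot nu.
Proof.
move=> cmu cnu; apply: norm_MKstar_le => f f1.
by rewrite (le_trans (norm_vintB_le cmu.1 cnu.1 f1.1))// lerD// norm_MKstar_ub.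
Qed.

Lemma norm_MKB mu nu : cabv0 mu -> cabv0 nu ->
  norm_MK dot (mu - nu) <= norm_MK dot mu + norm_MK dot nu.
Proof.
move=> cmu cnu; apply: norm_MK_le => f f1.
by rewrite (le_trans (norm_vintB_le cmu.1 cnu.1 f1.1))// lerD// norm_MK_ub.
Qed.

Lemma norm_H_ub mu nu : cabv mu -> cabv0 nu ->
  norm_H dot mu <= norm_MKstar dot nu + vnorm (mu - nu).
Proof.
move=> cmu cnu; apply: ge_inf; last by exists nu.
exists 0 => _ [nu' cnu' <-]; rewrite addr_ge0 ?norm_MKstar_ge0//.
by apply: vnorm_ge0; have [] := cabvB cmu cnu'.1.
Qed.

Lemma cabv0_0 : cabv0 (0 : set T -> X).
Proof.
have [t _] := T_inhabited.
(* The zero measure is written as a difference of two equal Dirac measures. *)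
by rewrite -(subrr (vdirac t 0)); exact: vdiracB_cabv0.
Qed.

Lemma norm_H_lb mu (M : R) :
  (forall nu, cabv0 nu -> M <= norm_MKstar dot nu + vnorm (mu - nu)) ->
  M <= norm_H dot mu.
Proof.
move=> h; apply: lb_le_inf; last by move=> _ [nu cnu <-]; exact: h.
by eexists; exists 0; first exact: cabv0_0.
Qed.

(** Subtracting a decomposition of [nu] from one of [mu] gives a decomposition of [mu - nu]; the
    infimum is then taken over each in turn. *)
Lemma norm_HB mu nu : cabv mu -> cabv nu ->
  norm_H dot (mu - nu) <= norm_H dot mu + norm_H dot nu.
Proof.
move=> cmu cnu; rewrite -lerBlDr; apply: norm_H_lb => mu' cmu'.
rewrite lerBlDr -lerBlDl; apply: norm_H_lb => nu' cnu'; rewrite lerBlDl.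
apply: le_trans (norm_H_ub (cabvB cmu cnu) (cabv0B cmu' cnu')) _.
rewrite addrACA lerD ?norm_MKstarB//.
have -> : mu - nu - (mu' - nu') = (mu - mu') - (nu - nu').
  by rewrite !opprB (addrC nu' (- mu')) addrACA (addrC (- nu)).
by have [] := vnormB_le (cabvB cmu cmu'.1) (cabvB cnu cnu'.1).
Qed.

End norms.

(** * Criteria for metrics and Lipschitz equivalence *)

Section metrics.
Context {R : realType} {T : Type}.
Implicit Types (r d : T -> T -> R).

(* The third hypothesis with [t = s] gives the symmetry of [r]. *)
Lemma is_metric_sub r : (forall t s, 0 <= r t s) ->
  (forall t s, r t s = 0 <-> t = s) ->
  (forall t s u, r t u <= r t s + r u s) -> is_metric r.
Proof.
move=> r0 req rsub.
have rle t s : r t s <= r s t.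
  by have := rsub t t s; rewrite (req t t).2// add0r.
have rC t s : r t s = r s t by apply/eqP; rewrite eq_le !rle.
by split=> // t s u; rewrite (rC s u).
Qed.

(** The lower bound separates points, the upper bound makes [r] vanish on the diagonal. *)
Lemma is_metric_between r d (a : R) : is_metric d -> 0 < a ->
  (forall t s, a * d t s <= r t s <= d t s) ->
  (forall t s u, r t u <= r t s + r u s) -> is_metric r.
Proof.
move=> [d0 deq _ _] a0 adr rsub.
have r0 t s : 0 <= r t s.
  by have /andP[+ _] := adr t s; apply: le_trans; rewrite mulr_ge0// ltW.
apply: is_metric_sub => // t s; split=> [rts|ts].
  apply/deq/eqP; rewrite eq_le d0 andbT.
  by have /andP[+ _] := adr t s; rewrite rts pmulr_rle0.
by apply/eqP; rewrite eq_le r0 andbT -((deq t s).2 ts); have /andP[] := adr t s.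
Qed.

Lemma lipschitz_equivalent_between r1 r2 d (a1 a2 : R) : 0 < a1 -> 0 < a2 ->
  (forall t s, a1 * d t s <= r1 t s <= d t s) ->
  (forall t s, a2 * d t s <= r2 t s <= d t s) -> lipschitz_equivalent r1 r2.
Proof.
(* The chain is [a2 * r1 <= a2 * d <= r2 <= d <= a1^-1 * r1]. *)
move=> a10 a20 h1 h2; exists a2, a1^-1; split=> //; first by rewrite invr_gt0.
move=> t s; have /andP[l1 u1] := h1 t s; have /andP[l2 u2] := h2 t s.
apply/andP; split; first by apply: le_trans l2; rewrite ler_pM2l.
by apply: le_trans u2 _; rewrite ler_pdivlMl.
Qed.

End metrics.

Lemma mdist_is_metric {R : realType} (T : metricType R) : is_metric (@mdist R T).
Proof.
split=> [t s|t s|t s|t s u]; [exact: mdist_ge0| |exact: metric_sym|exact: metric_triangle].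
by split=> [/mdist_positivity|->]; last exact: mdistxx.
Qed.

(** If all sets are open, the cover by singletons has a finite subcover. Conversely, finite sets in
    a metric space are closed, in particular every complement. *)
Lemma finite_all_open {R : realType} (T : metricType R) : compact [set: T] ->
  (forall U : set T, open U) <-> finite_set [set: T].
Proof.
move=> cT; split=> [oT|fT U].
  have [cs hcs] := compact_subcover cT (fun c : T => oT [set c]) (fun=> erefl).
  apply: (@sub_finite_set _ _ [set` cs]); last exact: finite_seq.
  by move=> t _; have [c ccs /= ->] := hcs t.
rewrite -(setCK U) openC.
have := hausdorff_accessible (@metric_hausdorff R T).
by move=> /accessible_finite_set_closed; apply; exact: sub_finite_set fT.
Qed.

(** * The metrics on T induced by the norms *)

Section dirac_metrics.
Context {R : realType} {k : scalar_kind}.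
Local Notation K := (scalars R k).
Context {T : metricType R} {X : completeNormedModType K}.
Hypothesis T_compact : compact [set: T].
Hypothesis T_inhabited : exists t : T, True.
Variable dot : {dot X for @scal_conj R k}.
Hypothesis dot_norm : forall v : X, dot v v = `|v| ^+ 2.
Variable x : X.
Hypothesis x1 : norm x = 1.
Implicit Types (f : T -> X) (t s u : T).

(** Turns subadditivity of a norm on differences into the third hypothesis of [is_metric_sub]. *)
Lemma vdirac_sub t s u :
  vdirac t x - vdirac u x = (vdirac t x - vdirac s x) - (vdirac u x - vdirac s x).
Proof. by rewrite opprB addrA subrK. Qed.

Lemma vint_vdiracB_le t s f : L1 f ->
  norm (vint dot (vdirac t x - vdirac s x) f : K^o) <= mdist t s.
Proof.
move=> f1; rewrite vint_vdiracB ?f1.1//; last exact: f1.1.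
apply: le_trans (cauchy_schwarz dot_norm _ _) _.
by rewrite x1 mulr1 L1_dist.
Qed.

Lemma vint_vdiracB_dist_fun (c : R) t s : 0 <= c ->
  norm (vint dot (vdirac t x - vdirac s x) (dist_fun c s x) : K^o) = c * mdist t s.
Proof.
move=> c0; rewrite vint_vdiracB//; last by exists c; exact: dist_fun_lip.
rewrite /dist_fun mdistxx mulr0 of_real0 scale0r subr0 dotZl dot_norm.
rewrite -of_real_norm x1 of_real1 expr1n mulr1 norm_of_real ger0_norm//.
by rewrite mulr_ge0// mdist_ge0.
Qed.

Lemma rho_MKstarE t s : rho (norm_MKstar dot) x t s = mdist t s.
Proof.
apply/eqP; rewrite eq_le; apply/andP; split.
  by apply: norm_MKstar_le => // f f1; exact: vint_vdiracB_le.
rewrite -[leLHS]mul1r -vint_vdiracB_dist_fun//.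
apply: norm_MKstar_ub => //; first exact: vdiracB_cabv0.
have lb := dist_fun_lip s ler01 x1.
by split; [exists 1|exact: norm_L_le].
Qed.

Lemma rho_MK_bounds t s :
  (1 + diam T)^-1 * mdist t s <= rho (norm_MK dot) x t s <= mdist t s.
Proof.
have D0 := diam_ge0 T_compact T_inhabited.
have c0 : 0 <= (1 + diam T)^-1 by rewrite invr_ge0 addr_ge0.
apply/andP; split; last first.
  by apply: norm_MK_le => // f /(BL1_L1 T_inhabited) f1; exact: vint_vdiracB_le.
rewrite -vint_vdiracB_dist_fun//; apply: norm_MK_ub => //; first exact: vdiracB_cabv0.
have lb := dist_fun_lip s c0 x1; split; first by eexists; exact: lb.
(* With factor [c], the sup norm is at most [c * diam T] and the Lipschitz constant at most [c];
   hence the choice of [c] with [c * (1 + diam T) = 1]. *)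
have le u : norm (dist_fun (1 + diam T)^-1 s x u) <= (1 + diam T)^-1 * diam T.
  by rewrite dist_fun_norm// ler_wpM2l// mdist_diam.
apply: le_trans (lerD (norm_sup_le T_inhabited le) (norm_L_le lb)) _.
by rewrite -[X in _ + X]mulr1 -mulrDr (addrC (diam T)) mulVf// gt_eqF// ltr_pwDl.
Qed.

Lemma rho_H_bounds t s :
  (Num.max (diam T) 1)^-1 * mdist t s <= rho (norm_H dot) x t s <= mdist t s.
Proof.
(* [1 <= M] puts the test function in [L1], and [diam T <= M] bounds its sup norm by 1. *)
set M := Num.max _ _.
have M1 : 1 <= M by rewrite le_max lexx orbT.
have M0 : 0 < M := lt_le_trans ltr01 M1.
have c0 : 0 <= M^-1 by rewrite invr_ge0 ltW.
have cmu := vdiracB_cabv0 x t s; apply/andP; split; last first.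
  apply: le_trans (norm_H_ub T_compact T_inhabited dot_norm cmu.1 cmu) _.
  by rewrite subrr vnorm0 addr0 -[leRHS]rho_MKstarE.
apply: norm_H_lb => // nu cnu.
rewrite -vint_vdiracB_dist_fun//; set f := dist_fun _ _ _.
have lb : lip_bound f M^-1 := dist_fun_lip s c0 x1.
have lf : lip f by exists M^-1.
have f1 : L1 f by split=> //; apply: le_trans (norm_L_le lb) _; rewrite invf_le1.
have cd := cabvB cmu.1 cnu.1.
have := vintB dot_norm T_compact lf (cabv_bounded_additive cmu.1)
  (cabv_bounded_additive cnu.1) (cabv_bounded_additive cd).
set a := vint dot _ f; set b := vint dot _ f; set c := vint dot _ f => abc.
(* Here [b] is the integral against the Dirac difference, [c] the one against [nu], bounded by
   [norm_MKstar], and [a] the one against the remainder, bounded by its variation. *)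
have -> : b = c + a by rewrite abc addrC subrK.
apply: le_trans (norm_D _ _) _; rewrite lerD ?norm_MKstar_ub//.
have := @vint_le _ _ _ _ dot dot_norm _ f 0 1 T_compact lf (cabv_bounded_additive cd) ler01.
rewrite dot0l subr0 mul1r; apply => u; rewrite subr0 dist_fun_norm//.
rewrite mulrC ler_pdivrMr// mul1r (le_trans (mdist_diam u s T_compact))//.
by rewrite le_max lexx.
Qed.

Lemma rho_vE t s : rho (@vnorm R k T X) x t s = if t == s then 0 else 2.
Proof.
rewrite /rho; case: eqVneq => [->|/eqP ts]; first by rewrite subrr vnorm0.
by rewrite vnorm_vdiracB// x1.
Qed.

Lemma rho_v_is_metric : is_metric (rho (@vnorm R k T X) x : T -> T -> R).
Proof.
apply: is_metric_sub => [t s|t s|t s u]; rewrite ?rho_vE.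
- by case: ifP.
- case: eqVneq => // ts; split=> [/eqP|/eqP]; first by rewrite pnatr_eq0.
  by rewrite (negbTE ts).
- rewrite -!rho_vE /rho (vdirac_sub t s u).
  by have [] := vnormB_le (vdiracB_cabv0 x t s).1 (vdiracB_cabv0 x u s).1.
Qed.

Lemma rho_v_discrete (U : set T) : metric_open (rho (@vnorm R k T X) x) U.
Proof.
(* Distinct points are at distance exactly 2, so the open ball of radius 2 is a singleton. *)
move=> t Ut; exists 2 => // s /=; rewrite rho_vE.
by case: eqVneq => [<-//|]; rewrite ltxx.
Qed.

End dirac_metrics.

Theorem theorem29 (R : realType) (T : metricType R)
    (T_compact : compact [set: T]) (T_two : exists t s : T, t <> s)
    (k : scalar_kind) (X : completeNormedModType (scalars R k))
    (dot : {dot X for @scal_conj R k})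
    (dot_norm : forall v : X, dot v v = `|v| ^+ 2)
    (x : X) (x_unit : `|x| = 1) :
  let d : T -> T -> R := mdist in
  let rho_MK : T -> T -> R := rho (norm_MK dot) x in
  let rho_MKs : T -> T -> R := rho (norm_MKstar dot) x in
  let rho_H : T -> T -> R := rho (norm_H dot) x in
  let rho_v : T -> T -> R := rho (@vnorm R k T X) x in
  [/\ (forall r : T -> T -> R,
         [set d; rho_MK; rho_MKs; rho_H] r -> is_metric r),
      (forall r1 r2 : T -> T -> R,
         [set d; rho_MK; rho_MKs; rho_H] r1 ->
         [set d; rho_MK; rho_MKs; rho_H] r2 -> lipschitz_equivalent r1 r2),
      [/\ (forall t s, (1 + diam T)^-1 * d t s <= rho_MK t s <= d t s),
          (forall t s, rho_MKs t s = d t s) &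
          (forall t s, (Num.max (diam T) 1)^-1 * d t s <= rho_H t s <= d t s)] &
      [/\ is_metric rho_v,
          (forall U : set T, metric_open rho_v U) &
          metric_open rho_v = metric_open d <-> finite_set [set: T]]].
Proof.
move=> d rho_MK rho_MKs rho_H rho_v.
have T0 : exists t : T, True by have [t _] := T_two; exists t.
have x1 : norm x = 1 by apply: norm_eq; rewrite of_real1.
have D0 := diam_ge0 T_compact T0.
have MKb : forall t s, (1 + diam T)^-1 * d t s <= rho_MK t s <= d t s.
  exact: rho_MK_bounds.
have Hb : forall t s, (Num.max (diam T) 1)^-1 * d t s <= rho_H t s <= d t s.
  exact: rho_H_bounds.
have MKsE : rho_MKs = d.
  by apply/funext => t; apply/funext => s; exact: rho_MKstarE.
have a1 : 0 < (1 + diam T)^-1 by rewrite invr_gt0 ltr_pwDl.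
have a2 : 0 < (Num.max (diam T) 1)^-1 by rewrite invr_gt0 lt_max ltr01 orbT.
have dm : is_metric d := mdist_is_metric T.
have cab (t s : T) := vdiracB_cabv0 x t s.
(* Every metric of the family lies between a positive multiple of [d] and [d], so any two of them
   can be compared through [d]. *)
have between r : [set d; rho_MK; rho_MKs; rho_H] r ->
    exists2 a, 0 < a & forall t s, a * d t s <= r t s <= d t s.
  have db : exists2 a, 0 < a & forall t s, a * d t s <= d t s <= d t s.
    by exists 1 => // t s; rewrite mul1r lexx.
  move=> [[[->|->]|->]|->]; rewrite ?MKsE//.
    by exists (1 + diam T)^-1.
  by exists (Num.max (diam T) 1)^-1.
split.
- move=> r [[[->|->]|->]|->]; rewrite ?MKsE//.
  + apply: (is_metric_between dm a1 MKb) => t s u.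
    by rewrite /rho_MK /rho (vdirac_sub x t s u) norm_MKB.
  + apply: (is_metric_between dm a2 Hb) => t s u.
    by rewrite /rho_H /rho (vdirac_sub x t s u) norm_HB//; exact: (cab _ _).1.
- move=> r1 r2 /between[b1 b10 h1] /between[b2 b20 h2].
  exact: lipschitz_equivalent_between h1 h2.
- by split=> // t s; rewrite MKsE.
- split; [exact: rho_v_is_metric|exact: rho_v_discrete|].
  (* All sets are open for [rho_v], so equality of the topologies means that all sets are open for
     [d]. *)
  rewrite -finite_all_open// /d metric_open_mdist; split=> [e U|oT].
    have : metric_open rho_v U by exact: rho_v_discrete.
    by rewrite e.
  by apply/seteqP; split=> U _; [exact: oT|exact: rho_v_discrete].
Qed.
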